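(* Let $\mathcal{G}$ be an undirected and connected matrix-weighted graph on $\{1,\dots,n\}$ with symmetric matrix weights $\mathbf{A}_{ij}=\mathbf{A}_{ji}\ge 0$ in $\mathbb{R}^{d\times d}$ ($d\ge 2$), matrix-weighted Laplacian $\mathbf{L}$ and block degrees $\mathbf{D}_i$. For each $i$ let $\beta_i>0$, $\alpha_i=(\|\mathbf{D}_i\|+\beta_i)^{-1}$, and let $\mathbf{G}=\mathrm{diag}(\alpha_1^{-1}\mathbf{I}_d,\dots,\alpha_n^{-1}\mathbf{I}_d)$. Consider the iteration $$\mathbf{x}(k+1)=(\mathbf{I}_{dn}-\mathbf{G}^{-1}\mathbf{L})\mathbf{x}(k),\qquad k=0,1,2,\dots$$ Then the following are equivalent: (a) for every initial vector $\mathbf{x}(0)\in\mathbb{R}^{dn}$, the sequence $\{\mathbf{x}(k)\}$ converges geometrically to a consensus $\mathbf{x}^*=\mathbf{1}_n\otimes\hat{\mathbf{x}}$ for some constant vector $\hat{\mathbf{x}}\in\mathbb{R}^d$ (depending on $\mathbf{x}(0)$); (b) $\mathrm{null}(\mathbf{L})=\mathrm{range}(\mathbf{1}_n\otimes\mathbf{I}_d)$.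
   Context: A matrix-weighted graph $\mathcal{G}=(\mathcal{V},\mathcal{E},\mathcal{A})$ has vertex set $\mathcal{V}=\{1,\dots,n\}$, edge set $\mathcal{E}\subseteq\mathcal{V}\times\mathcal{V}$ without self-loops, and a weight $\mathbf{A}_{ij}\in\mathbb{R}^{d\times d}$ for each $(i,j)\in\mathcal{E}$ that is a symmetric positive semidefinite matrix; $\mathbf{A}_{ij}=\mathbf{0}$ if $(i,j)\notin\mathcal{E}$. The graph is undirected: $(i,j)\in\mathcal{E}$ implies $(j,i)\in\mathcal{E}$. $\mathcal{N}_i=\{j:(i,j)\in\mathcal{E}\}$. Symmetric matrix weights means $\mathbf{A}_{ij}=\mathbf{A}_{ji}$ for all $(i,j)\in\mathcal{E}$. $\mathbf{D}_i=\sum_{j\in\mathcal{N}_i}\mathbf{A}_{ij}$, $\mathbf{D}=\mathrm{diag}(\mathbf{D}_1,\dots,\mathbf{D}_n)$, $\mathbf{A}=[\mathbf{A}_{ij}]\in\mathbb{R}^{nd\times nd}$, and the matrix-weighted Laplacian is $\mathbf{L}=\mathbf{D}-\mathbf{A}$. $\|\cdot\|$ is the Euclidean norm on vectors and the induced (spectral) norm on matrices; $\mathbf{1}_n$ is the all-ones vector in $\mathbb{R}^n$. The state $\mathbf{x}(k)=[\mathbf{x}_1^\top(k),\dots,\mathbf{x}_n^\top(k)]^\top$ stacks the agents' vectors $\mathbf{x}_i(k)\in\mathbb{R}^d$; the iteration is equivalent to $\mathbf{x}_i(k+1)=\mathbf{x}_i(k)-\alpha_i\sum_{j\in\mathcal{N}_i}\mathbf{A}_{ij}(\mathbf{x}_i(k)-\mathbf{x}_j(k))$.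 Converging geometrically to $\mathbf{x}^*$ means there exist $C\ge 0$ and $q\in[0,1)$ with $\|\mathbf{x}(k)-\mathbf{x}^*\|\le Cq^k$ for all $k$. *)

(* Defs.v *)
From mathcomp Require Import all_boot all_order all_algebra.
From mathcomp Require Import all_classical all_reals.

Set Implicit Arguments.
Unset Strict Implicit.
Unset Printing Implicit Defensive.

Import Order.TTheory GRing.Theory Num.Theory.

Local Open Scope classical_set_scope.
Local Open Scope ring_scope.

(* Vectors are column vectors. R^(nd) is rendered as 'cV[R]_(\sum_(i < n) d),
   the index type of the block-matrix operators \mxcol, \mxdiag and \mxblock. *)

Definition norm2 (R : realType) (m : nat) (v : 'cV[R]_m) : R :=
  Num.sqrt (\sum_i v i 0 ^+ 2).

Definition opnorm2 (R : realType) (m p : nat) (M : 'M[R]_(m, p)) : R :=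
  sup [set norm2 (M *m v) | v in [set v : 'cV[R]_p | norm2 v <= 1]].

Definition psdmx (R : realType) (m : nat) (M : 'M[R]_m) : Prop :=
  M^T = M /\ forall v : 'cV[R]_m, 0 <= (v^T *m M *m v) 0 0.

Definition null (R : realType) (m p : nat) (M : 'M[R]_(m, p)) : set 'cV[R]_p :=
  [set v | M *m v = 0].

Definition mxrange (R : realType) (m p : nat) (M : 'M[R]_(m, p)) :
    set 'cV[R]_m :=
  range (fun v : 'cV[R]_p => M *m v).

(* The Kronecker product u (x) B of a column vector u and a matrix B. *)
Definition ckron (R : realType) (n d p : nat) (u : 'cV[R]_n) (B : 'M[R]_(d, p)) :
    'M[R]_(\sum_(i < n) d, p) :=
  \mxcol_(i < n) (u i 0 *: B).

Definition cvg_geometrically (R : realType) (m : nat) (x : nat -> 'cV[R]_m)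
    (l : 'cV[R]_m) : Prop :=
  exists C q : R, [/\ 0 <= C, 0 <= q < 1 &
    forall k : nat, norm2 (x k - l) <= C * q ^+ k].

(* A possibly directed graph; an edge may carry the zero weight. *)
Record mwgraph (R : realType) (n d : nat) := MWGraph {
  edge : rel 'I_n;
  weight : 'I_n -> 'I_n -> 'M[R]_d;
  edge_irrefl : irreflexive edge;
  weight_psd : forall i j, edge i j -> psdmx (weight i j);
  weight_nonedge : forall i j, ~~ edge i j -> weight i j = 0 }.

Section GraphNotions.
Variables (R : realType) (n d : nat) (G : mwgraph R n d).

Definition undirected : Prop := forall i j, edge G i j -> edge G j i.

Definition graph_connected : Prop := forall i j, connect (edge G) i j.

Definition symmetric_weights : Prop :=
  forall i j, edge G i j -> weight G i j = weight G j i.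

Definition block_degree (i : 'I_n) : 'M[R]_d :=
  \sum_(j < n | edge G i j) weight G i j.

Definition degree_mx : 'M[R]_(\sum_(i < n) d) :=
  \mxdiag_(i < n) block_degree i.

Definition adjacency_mx : 'M[R]_(\sum_(i < n) d) :=
  \mxblock_(i < n, j < n) weight G i j.

Definition laplacian : 'M[R]_(\sum_(i < n) d) := degree_mx - adjacency_mx.

End GraphNotions.

Definition step_size (R : realType) (n d : nat) (G : mwgraph R n d)
    (beta : 'I_n -> R) (i : 'I_n) : R :=
  (opnorm2 (block_degree G i) + beta i)^-1.

Definition gain_mx (R : realType) (n d : nat) (G : mwgraph R n d)
    (beta : 'I_n -> R) : 'M[R]_(\sum_(i < n) d) :=
  \mxdiag_(i < n) ((step_size G beta i)^-1 *: (1%:M : 'M[R]_d)).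

Definition iteration_mx (R : realType) (n d : nat) (G : mwgraph R n d)
    (beta : 'I_n -> R) : 'M[R]_(\sum_(i < n) d) :=
  1%:M - invmx (gain_mx G beta) *m laplacian G.

(* Main.v *)
Require Import Defs.
From mathcomp Require Import all_boot all_order all_algebra.
From mathcomp Require Import all_classical all_reals.
From mathcomp Require Import zify ring lra.

Set Implicit Arguments.
Unset Strict Implicit.
Unset Printing Implicit Defensive.

Import Order.TTheory GRing.Theory Num.Theory.

Local Open Scope classical_set_scope.
Local Open Scope ring_scope.

(** The null space of the Laplacian [L] always contains the consensus vectors,
    and each of its elements is a fixed point of the iteration.  If every
    trajectory converges to a consensus, so does the constant trajectory at an
    element of the null space, which is therefore a consensus.

    Conversely, write [G] for the gain matrix, [D] for the block degrees and [A]
    for the adjacency matrix.  The quadratic forms of [L = D - A] and of [D + A]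
    are half the sums over the pairs [(i, j)] of the forms of the weights at
    [x_i - x_j] and at [x_i + x_j]; both are semidefinite.  Since [D_i] is at
    most [||D_i||] and [beta_i > 0], the matrix [G - D] is definite, hence so is
    [2 G - L = 2 (G - D) + (D + A)] ([pdmx_gain_laplacian]).

    The rest holds for any semidefinite [L] and definite [G] such that [2 G - L]
    is definite ([iteration_cvg]).  The map [M = 1 - G^-1 L] fixes the null space
    of [L] and preserves the range of [G^-1 L]; the whole space is the sum of the
    two ([null_range_decomp]).  The energy [E w = w^T G w] drops by at least a
    fixed multiple of [w^T L w] under [M] ([energy_decrease]), and on the range
    of [G^-1 L] the form of [L] dominates the energy ([coercive_range]).  So [E]
    contracts there by a factor below 1, and every trajectory converges
    geometrically to the component of its initial vector in the null space of
    [L], a consensus under the hypothesis on that space.  The constants come from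
    the Cauchy-Schwarz inequality for semidefinite forms rather than from
    eigenvalues. *)

(** * Bilinear forms and positive semidefinite matrices *)

Definition form (R : realType) (m : nat) (M : 'M[R]_m) (u v : 'cV[R]_m) : R :=
  (u^T *m M *m v) 0 0.

Definition pdmx (R : realType) (m : nat) (M : 'M[R]_m) : Prop :=
  M^T = M /\ forall v : 'cV[R]_m, v != 0 -> 0 < form M v v.

Section Forms.
Variables (R : realType) (m : nat).
Implicit Types (M S : 'M[R]_m) (u v w : 'cV[R]_m).

Lemma formDl M u v w : form M (u + v) w = form M u w + form M v w.
Proof. by rewrite /form linearD /= !mulmxDl mxE. Qed.

Lemma formDr M u v w : form M w (u + v) = form M w u + form M w v.
Proof. by rewrite /form mulmxDr mxE. Qed.

Lemma formZl M a u v : form M (a *: u) v = a * form M u v.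
Proof. by rewrite /form linearZ /= -!scalemxAl mxE. Qed.

Lemma formZr M a u v : form M u (a *: v) = a * form M u v.
Proof. by rewrite /form -scalemxAr mxE. Qed.

Lemma formNl M u v : form M (- u) v = - form M u v.
Proof. by rewrite -scaleN1r formZl mulN1r. Qed.

Lemma formNr M u v : form M u (- v) = - form M u v.
Proof. by rewrite -scaleN1r formZr mulN1r. Qed.

Lemma formD M S u v : form (M + S) u v = form M u v + form S u v.
Proof. by rewrite /form mulmxDr mulmxDl mxE. Qed.

Lemma formZ M a u v : form (a *: M) u v = a * form M u v.
Proof. by rewrite /form -scalemxAr -scalemxAl mxE. Qed.

Lemma formN M u v : form (- M) u v = - form M u v.
Proof. by rewrite -scaleN1r formZ mulN1r. Qed.

Lemma form_sum (I : finType) (P : pred I) (F : I -> 'M[R]_m) u v :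
  form (\sum_(i | P i) F i) u v = \sum_(i | P i) form (F i) u v.
Proof. by rewrite /form mulmx_sumr mulmx_suml summxE. Qed.

Lemma formC M u v : M^T = M -> form M u v = form M v u.
Proof.
move=> symM; rewrite /form -[in LHS](trmxK (u^T *m M *m v)) mxE.
by rewrite !trmx_mul trmxK symM mulmxA.
Qed.

Lemma form_mulr M S u v w : M *m v = S *m w -> form M u v = form S u w.
Proof. by move=> e; rewrite /form -!mulmxA e. Qed.

Lemma norm2_ge0 v : 0 <= norm2 v.
Proof. exact: sqrtr_ge0. Qed.

Lemma norm2_sqr v : norm2 v ^+ 2 = form 1%:M v v.
Proof.
rewrite sqr_sqrtr; last by apply: sumr_ge0 => i _; rewrite sqr_ge0.
by rewrite /form mulmx1 mxE; apply: eq_bigr => i _; rewrite mxE expr2.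
Qed.

Lemma norm2_eq0 v : (norm2 v == 0) = (v == 0).
Proof.
apply/eqP/eqP => [v0|->]; last first.
  by rewrite /norm2 big1 ?sqrtr0 // => i _; rewrite mxE expr0n.
have /eqP : \sum_i v i 0 ^+ 2 = 0.
  rewrite -[LHS]sqr_sqrtr; last by apply: sumr_ge0 => i _; rewrite sqr_ge0.
  by rewrite -/(norm2 v) v0 expr0n.
rewrite psumr_eq0 => [/allP v0'|i _]; last by rewrite sqr_ge0.
apply/matrixP => i j; rewrite ord1 !mxE.
by have := v0' i (mem_index_enum _); rewrite /= sqrf_eq0 => /eqP.
Qed.

Lemma norm2Z a v : 0 <= a -> norm2 (a *: v) = a * norm2 v.
Proof.
move=> a0; apply/eqP.
rewrite -(@eqrXn2 _ 2) // ?mulr_ge0 ?norm2_ge0 // exprMn !norm2_sqr.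
by rewrite formZl formZr mulrA.
Qed.

Lemma psdmx_form_ge0 S v : psdmx S -> 0 <= form S v v.
Proof. by case=> _; apply. Qed.

Lemma psdmx1 : psdmx (1%:M : 'M[R]_m).
Proof.
by split=> [|v]; rewrite ?trmx1 // -/(form 1%:M v v) -norm2_sqr sqr_ge0.
Qed.

Lemma pdmx_psd S : pdmx S -> psdmx S.
Proof.
case=> symS posS; split=> // v; rewrite -/(form S v v).
by have [->|/posS/ltW//] := eqVneq v 0; rewrite /form mulmx0 mxE.
Qed.

Lemma pdmx_unit S : pdmx S -> S \in unitmx.
Proof.
case=> symS posS; rewrite -unitmx_tr -row_free_unit -kermx_eq0.
apply/rowV0P => v /sub_kermxP vS0; apply/eqP; apply: contraT => v0.
have /posS : v^T != 0 by rewrite trmx_eq0.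
by rewrite /form trmxK -{1}symS vS0 mul0mx mxE ltxx.
Qed.

(** Expanding the nonnegative numbers [form S (c u - b v)], [form S (a v - b u)]
    and [form S (u - b v)], where [a], [b], [c] are the values of the form on
    [(u, u)], [(u, v)], [(v, v)], gives [c (a c - b^2)], [a (a c - b^2)] and
    [a - 2 b^2 + b^2 c]; the last one settles the case [a = c = 0]. *)
Lemma psdmx_CauchySchwarz S u v :
  psdmx S -> form S u v ^+ 2 <= form S u u * form S v v.
Proof.
move=> psdS; have symS := proj1 psdS.
have := psdmx_form_ge0 (form S v v *: u - form S u v *: v) psdS.
have := psdmx_form_ge0 (form S u u *: v - form S u v *: u) psdS.
have := psdmx_form_ge0 (u - form S u v *: v) psdS.
have := psdmx_form_ge0 u psdS; have := psdmx_form_ge0 v psdS.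
rewrite !(formDl, formDr, formZl, formZr, formNl, formNr) (formC v u symS).
move: (form S u u) (form S u v) (form S v v) => a b c.
rewrite !le0r => /orP[/eqP->|c0] /orP[/eqP->|a0] h1 h2 h3; nra.
Qed.

Lemma form_le M : exists2 c, 0 < c & forall v, form M v v <= c * norm2 v ^+ 2.
Proof.
exists (1 + \sum_i \sum_j `|M i j|) => [|v].
  by rewrite ltr_pwDl // sumr_ge0 // => i _; rewrite sumr_ge0.
have le_sqr i : v i 0 ^+ 2 <= norm2 v ^+ 2.
  rewrite sqr_sqrtr; last by apply: sumr_ge0 => k _; rewrite sqr_ge0.
  by rewrite (bigD1 i) //= lerDl sumr_ge0 // => k _; rewrite sqr_ge0.
rewrite mulrDl mul1r /form -mulmxA mxE.
rewrite -[leLHS]add0r lerD ?sqr_ge0 // mulr_suml ler_sum // => i _.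
rewrite !mxE mulr_sumr mulr_suml ler_sum // => j _.
apply: le_trans (ler_norm _) _; rewrite mulrCA normrM ler_wpM2l //.
rewrite ler_norml; have := le_sqr i; have := le_sqr j.
by move: (norm2 v ^+ 2) => s hi hj; apply/andP; split; nra.
Qed.

(** By the Cauchy-Schwarz inequality for [S], the fourth power of the norm of
    [w], which is the square of [form S (B^T w) w], is at most
    [form S (B^T w) (B^T w)] times [form S w w], and the first factor is at most
    a constant times the squared norm.  So a left inverse of [S] on a set of
    vectors makes the form coercive there. *)
Lemma psdmx_coercive S B : psdmx S ->
  exists2 c, 0 < c &
    forall w, w = B *m S *m w -> norm2 w ^+ 2 <= c * form S w w.
Proof.
move=> psdS; have [c c0 hc] := form_le (B *m S *m B^T).
exists c => // w ew; have := psdmx_CauchySchwarz (B^T *m w) w psdS.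
have -> : form S (B^T *m w) w = norm2 w ^+ 2.
  rewrite norm2_sqr /form mulmx1 trmx_mul trmxK -!mulmxA.
  by rewrite [B *m _]mulmxA -ew.
have -> : form S (B^T *m w) (B^T *m w) = form (B *m S *m B^T) w w.
  by rewrite /form trmx_mul trmxK !mulmxA.
have := hc w; have := psdmx_form_ge0 w psdS.
have := sqr_ge0 (norm2 w); move: (norm2 w ^+ 2) (form S w w) => N s.
rewrite le0r => /orP[/eqP->|N0] s0 h1 h2; first by rewrite mulr_ge0 // ltW.
rewrite -(ler_pM2l N0); apply: le_trans h2 _.
by rewrite mulrCA mulrA ler_wpM2r.
Qed.

Lemma pdmx_coercive S : pdmx S ->
  exists2 c, 0 < c & forall w, norm2 w ^+ 2 <= c * form S w w.
Proof.
move=> pdS; have [c c0 hc] := psdmx_coercive (invmx S) (pdmx_psd pdS).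
by exists c => // w; apply: hc; rewrite mulVmx ?mul1mx // pdmx_unit.
Qed.

End Forms.

(** * The preconditioned gradient iteration of a semidefinite matrix *)

Section PreconditionedIteration.
Variables (R : realType) (m : nat) (L G : 'M[R]_m).
Hypotheses (psdL : psdmx L) (pdG : pdmx G) (pdGL : pdmx (2%:R *: G - L)).
Let M : 'M[R]_m := 1%:M - invmx G *m L.
Let E (v : 'cV[R]_m) : R := form G v v.

Let symL : L^T = L. Proof. by case: psdL. Qed.
Let symG : G^T = G. Proof. by case: pdG. Qed.

Let mulGz (v : 'cV[R]_m) : G *m (invmx G *m L *m v) = L *m v.
Proof. by rewrite -mulmxA mulKVmx // pdmx_unit. Qed.

(** If [L G^-1 L v = 0], then [z = G^-1 L v] satisfies [z^T G z = 0], so that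
    [z = 0] and [L v = G z = 0].  Hence [L] and [L G^-1 L] have the same kernel,
    the same rank and the same row space. *)
Lemma factor_through_square : exists B : 'M[R]_m, L = B *m (L *m invmx G *m L).
Proof.
apply/submxP; set K := L *m invmx G *m L.
have KL : (K <= L)%MS by exact: submxMl.
have kerK : (kermx K <= kermx L)%MS.
  apply/sub_kermxP; apply/row_matrixP => i; rewrite row_mul row0.
  set v := row i _; have vK : v *m K = 0.
    by rewrite /v -row_mul mulmx_ker row0.
  have symK : K^T = K by rewrite /K !trmx_mul trmx_inv symL symG mulmxA.
  have Kv : K *m v^T = 0 by rewrite -symK -trmx_mul vK trmx0.
  apply/trmx_inj; rewrite trmx_mul symL trmx0.
  have [//|Lv0] := eqVneq (L *m v^T) 0.
  have z0 : invmx G *m L *m v^T != 0.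
    by apply: contraNneq Lv0 => z0; rewrite -mulGz z0 mulmx0.
  have := (proj2 pdG) _ z0; rewrite (form_mulr _ (mulGz v^T)).
  rewrite formC // /form mulmxA -!mulmxA.
  by rewrite [L *m (_ *m _)]mulmxA [_ *m (L *m _)]mulmxA -/K Kv mulmx0 mxE ltxx.
rewrite -(mxrank_leqif_sup KL) eqn_leq mxrankS //=.
have := mxrankS kerK; rewrite !mxrank_ker => le.
have := rank_leq_row K; have := rank_leq_row L; lia.
Qed.

(** The vector [x - G^-1 L y] is in the kernel of [L] when [y] solves
    [L G^-1 L y = L x]; transposing [factor_through_square] gives the solution
    [y = B^T x]. *)
Lemma null_range_decomp (x : 'cV[R]_m) :
  exists u y, L *m u = 0 /\ x = u + invmx G *m L *m y.
Proof.
have [B eL] := factor_through_square.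
have eL' : L = L *m invmx G *m L *m B^T.
  by rewrite -{1}symL [in LHS]eL !trmx_mul trmx_inv symL symG !mulmxA.
exists (x - invmx G *m L *m (B^T *m x)), (B^T *m x); split; last by rewrite subrK.
by rewrite mulmxBr !mulmxA -eL' subrr.
Qed.

(** If [w = G^-1 L y], then [L = B (L G^-1 L)] gives [w = G^-1 B (L w)], the
    left inverse that [psdmx_coercive] asks for. *)
Lemma coercive_range : exists2 c, 0 < c &
  forall w y, w = invmx G *m L *m y -> E w <= c * form L w w.
Proof.
have [B eL] := factor_through_square.
have [c c0 hc] := psdmx_coercive (invmx G *m B) psdL.
have [g g0 hg] := form_le G.
exists (g * c) => [|w y ew]; first exact: mulr_gt0.
apply: le_trans (hg w) _; rewrite -mulrA ler_pM2l //; apply: hc.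
by rewrite {1}ew {1}eL ew !mulmxA.
Qed.

(** With [z = G^-1 L x], the new energy [E (x - z)] is
    [E x - 2 (form L x x) + E z].  As [2 G - L] is definite, [L] is at most
    [(2 - delta) G] for some positive [delta]; since [E z = form L z x], the
    Cauchy-Schwarz inequality for [L] gives [E z <= (2 - delta) form L x x]. *)
Lemma energy_decrease : exists2 delta, 0 < delta &
  forall x, E (M *m x) <= E x - delta * form L x x.
Proof.
have [c c0 hc] := pdmx_coercive pdGL.
have [g g0 hg] := form_le G.
exists (1 + g * c)^-1 => [|x]; first by rewrite invr_gt0 addr_gt0 ?mulr_gt0.
(* The summand 1 makes [delta] at most 1; the case [E z = 0] below needs
   [2 - delta] to be nonnegative. *)
set delta := _^-1; pose z := invmx G *m L *m x.
have eM : M *m x = x - z by rewrite /M mulmxBl mul1mx.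
have Gz v : form G v z = form L v x by apply: form_mulr; exact: mulGz.
rewrite eM /E !(formDl, formDr, formNl, formNr) (formC z x symG) !Gz.
have CS := psdmx_CauchySchwarz z x psdL; have Lx := psdmx_form_ge0 x psdL.
have Ez : 0 <= form L z x by rewrite -Gz; exact/psdmx_form_ge0/pdmx_psd.
have Lz : form L z z <= (2%:R - delta) * form L z x.
  have : form L z x <= g * (c * form (2%:R *: G - L) z z).
    by rewrite -Gz; apply: le_trans (hg z) _; rewrite ler_pM2l.
  have := psdmx_form_ge0 z (pdmx_psd pdGL); rewrite formD formZ formN Gz => h0 h.
  rewrite mulrBl lerBrDr -lerBrDl /delta mulrC ler_pdivrMr; last first.
    by rewrite addr_gt0 ?mulr_gt0.
  by rewrite mulrC mulrDl mul1r -mulrA ler_wpDl.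
have delta1 : delta <= 1.
  by rewrite invf_le1 ?lerDl ?addr_gt0 ?mulr_ge0 ?mulr_gt0 ?ltW.
suff : form L z x <= (2%:R - delta) * form L x x by lra.
move: Ez; rewrite le0r => /orP[/eqP ez|Ez].
  by rewrite ez mulr_ge0 // subr_ge0 (le_trans delta1) ?ler1n.
rewrite -(ler_pM2l Ez); apply: le_trans (_ : form L z z * form L x x <= _).
  by rewrite -expr2.
by rewrite mulrCA mulrA ler_wpM2r // mulrC.
Qed.

Lemma energy_contraction : exists2 rho, 0 <= rho < 1 &
  forall w y, w = invmx G *m L *m y -> E (M *m w) <= rho * E w.
Proof.
have [delta delta0 hdelta] := energy_decrease.
have [c c0 hc] := coercive_range.
exists (c / (delta + c)) => [|w y ew].
  by rewrite divr_ge0 ?ltW ?addr_gt0 //= ltr_pdivrMr ?mul1r ?ltrDr ?addr_gt0.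
(* [rho] is [1 - delta / (delta + c)], at least [1 - delta / c], and is
   nonnegative whatever the constants. *)
have Lw := psdmx_form_ge0 w psdL.
apply: le_trans (hdelta w) _.
rewrite mulrAC ler_pdivlMr ?addr_gt0 //.
have := hc w y ew; move: (E w) (form L w w) Lw => e l l0 hel.
nra.
Qed.

Lemma range_invariant (y : 'cV[R]_m) :
  M *m (invmx G *m L *m y) = invmx G *m L *m (M *m y).
Proof. by rewrite /M !mulmxBl !mulmxBr !mul1mx !mulmxA. Qed.

Lemma iteration_cvg (x : nat -> 'cV[R]_m) :
  (forall k, x k.+1 = M *m x k) ->
  exists u, L *m u = 0 /\ cvg_geometrically x u.
Proof.
move=> hx; have [u [y0 [Lu ex0]]] := null_range_decomp (x 0%N).
exists u; split=> //.
have Mu : M *m u = u by rewrite /M mulmxBl mul1mx -mulmxA Lu mulmx0 subr0.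
have [rho /andP[rho0 rho1] hrho] := energy_contraction.
have [c c0 hc] := pdmx_coercive pdG.
have hk k : exists2 y, x k - u = invmx G *m L *m y &
    E (x k - u) <= rho ^+ k * E (x 0%N - u).
  elim: k => [|k [y ey hy]].
    by exists y0; rewrite ?expr0 ?mul1r // ex0 addrC addKr.
  have eS : x k.+1 - u = M *m (x k - u) by rewrite hx mulmxBr Mu.
  exists (M *m y); first by rewrite eS ey range_invariant.
  rewrite eS exprS -mulrA; apply: le_trans (_ : rho * E (x k - u) <= _).
    exact: hrho ey.
  by rewrite ler_wpM2l.
have E0 : 0 <= E (x 0%N - u) by exact/psdmx_form_ge0/pdmx_psd.
exists (Num.sqrt (c * E (x 0%N - u))), (Num.sqrt rho); split=> [||k].
- exact: sqrtr_ge0.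
- by rewrite sqrtr_ge0 -sqrtr1 ltr_sqrt.
rewrite -(@ler_pXn2r _ 2) ?nnegrE ?norm2_ge0 ?mulr_ge0 ?exprn_ge0 ?sqrtr_ge0 //.
have [y _ hy] := hk k.
apply: le_trans (hc _) _; rewrite exprMn exprAC !sqr_sqrtr ?mulr_ge0 ?(ltW c0) //.
by rewrite -mulrA ler_pM2l // mulrC.
Qed.

End PreconditionedIteration.

(** * The operator norm bounds the quadratic form *)

Lemma norm2_mul_le (R : realType) (m p : nat) (A : 'M[R]_(m, p)) :
  exists2 c, 0 <= c & forall v, norm2 (A *m v) <= c * norm2 v.
Proof.
have [c c0 hc] := form_le (A^T *m A); exists (Num.sqrt c) => [|v].
  exact: sqrtr_ge0.
rewrite -(@ler_pXn2r _ 2) ?nnegrE ?mulr_ge0 ?norm2_ge0 ?sqrtr_ge0 //.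
rewrite exprMn (sqr_sqrtr (ltW c0)) norm2_sqr; apply: le_trans (hc v).
by rewrite /form mulmx1 trmx_mul !mulmxA.
Qed.

Lemma norm2_le_opnorm2 (R : realType) (m p : nat) (A : 'M[R]_(m, p)) v :
  norm2 v <= 1 -> norm2 (A *m v) <= opnorm2 A.
Proof.
(* The supremum is meaningful because the set is bounded. *)
move=> v1; have [c c0 hc] := norm2_mul_le A.
apply: ub_le_sup; last by exists v.
exists c => _ [u /= u1 <-]; apply: le_trans (hc u) _.
by rewrite -[leRHS]mulr1 ler_wpM2l.
Qed.

Lemma opnorm2_ge0 (R : realType) (m p : nat) (A : 'M[R]_(m, p)) :
  0 <= opnorm2 A.
Proof.
have <- : norm2 (A *m 0) = 0 by apply/eqP; rewrite norm2_eq0 mulmx0.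
apply: norm2_le_opnorm2; suff /eqP-> : norm2 (0 : 'cV[R]_p) == 0 by [].
by rewrite norm2_eq0.
Qed.

Lemma norm2_mul_opnorm2 (R : realType) (m p : nat) (A : 'M[R]_(m, p)) v :
  norm2 (A *m v) <= opnorm2 A * norm2 v.
Proof.
have [->|v0] := eqVneq v 0.
  suff /eqP-> : norm2 (A *m 0) == 0 by rewrite mulr_ge0 ?opnorm2_ge0 ?norm2_ge0.
  by rewrite mulmx0 norm2_eq0.
have nv0 : 0 < norm2 v by rewrite lt0r norm2_eq0 v0 norm2_ge0.
rewrite -ler_pdivrMr // mulrC -norm2Z ?invr_ge0 ?norm2_ge0 // scalemxAr.
apply: norm2_le_opnorm2.
by rewrite norm2Z ?invr_ge0 ?norm2_ge0 // mulVf ?gt_eqF.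
Qed.

Lemma form_le_opnorm2 (R : realType) (m : nat) (A : 'M[R]_m) v :
  form A v v <= opnorm2 A * norm2 v ^+ 2.
Proof.
have CS := psdmx_CauchySchwarz v (A *m v) (psdmx1 R m).
have eA : form 1%:M v (A *m v) = form A v v by rewrite /form mulmx1 mulmxA.
move: CS; rewrite eA -!norm2_sqr -exprMn => CS.
apply: le_trans (_ : norm2 v * norm2 (A *m v) <= _); last first.
  by rewrite expr2 mulrCA ler_wpM2l ?norm2_ge0 ?norm2_mul_opnorm2.
apply: le_trans (ler_norm _) _.
by rewrite -(@ler_pXn2r _ 2) ?nnegrE ?mulr_ge0 ?norm2_ge0 // real_normK ?num_real.
Qed.

(** * Quadratic forms of block matrices *)

Section Blocks.
Variables (R : realType) (n d : nat).
Implicit Types (x : 'cV[R]_(\sum_(i < n) d)).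

Lemma form_mxdiag (D : 'I_n -> 'M[R]_d) x :
  form (\mxdiag_i D i) x x =
    \sum_i form (D i) (submxcol x i) (submxcol x i).
Proof.
rewrite /form -mulmxA -[x]submxcolK tr_mxcol mul_mxdiag_mxcol mul_mxrow_mxcol.
by rewrite summxE; apply: eq_bigr => i _; rewrite mxcolK mulmxA.
Qed.

Lemma form_mxblock (A : 'I_n -> 'I_n -> 'M[R]_d) x :
  form (\mxblock_(i, j) A i j) x x =
    \sum_i \sum_j form (A i j) (submxcol x i) (submxcol x j).
Proof.
rewrite /form -mulmxA -[x]submxcolK tr_mxcol mul_mxblock_mxrow mul_mxrow_mxcol.
rewrite summxE; apply: eq_bigr => i _; rewrite mulmx_sumr summxE.
by apply: eq_bigr => j _; rewrite !mxcolK mulmxA.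
Qed.

Lemma ckron_mul (u : 'cV[R]_n) (p q : nat) (B : 'M[R]_(d, p)) (C : 'M[R]_(p, q)) :
  ckron u B *m C = ckron u (B *m C).
Proof. by rewrite mxcol_mul; apply: eq_mxcol => i; rewrite scalemxAl. Qed.

End Blocks.

(** * The Laplacian and the gain matrix of an undirected graph *)

Section Graph.
Variables (R : realType) (n d : nat) (G : mwgraph R n d).
Hypotheses (undirG : undirected G) (symG : symmetric_weights G).
Implicit Types (x : 'cV[R]_(\sum_(i < n) d)).

Lemma psdmx_weight i j : psdmx (weight G i j).
Proof.
have [e|ne] := boolP (edge G i j); first exact: weight_psd e.
by rewrite weight_nonedge //; split=> [|v]; rewrite ?trmx0 // mulmx0 mul0mx mxE.
Qed.

Lemma weightC i j : weight G i j = weight G j i.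
Proof.
have [e|ne] := boolP (edge G i j); first exact: symG e.
rewrite !weight_nonedge //; apply: contraNN ne; exact: undirG.
Qed.

Lemma block_degreeE i : block_degree G i = \sum_j weight G i j.
Proof.
rewrite [RHS](bigID (edge G i)) /= [X in _ + X]big1 ?addr0 // => j ne.
by rewrite weight_nonedge.
Qed.

Lemma block_degree_sym i : (block_degree G i)^T = block_degree G i.
Proof.
rewrite block_degreeE linear_sum; apply: eq_bigr => j _.
by case: (psdmx_weight i j).
Qed.

Lemma laplacian_sym : (laplacian G)^T = laplacian G.
Proof.
rewrite linearB /= tr_mxdiag tr_mxblock; congr (_ - _).
  by apply: eq_mxdiag => i; rewrite block_degree_sym.
apply: eq_mxblock => i j; rewrite weightC; by case: (psdmx_weight i j).
Qed.

(** Symmetrizing the degree sum pairs the two ends of every edge. *)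
Lemma form_degree x : 2%:R * form (degree_mx G) x x =
  \sum_i \sum_j (form (weight G i j) (submxcol x i) (submxcol x i) +
                 form (weight G i j) (submxcol x j) (submxcol x j)).
Proof.
under [RHS]eq_bigr do rewrite big_split /=.
rewrite [RHS]big_split /= [X in _ = _ + X]exchange_big /=.
have -> : form (degree_mx G) x x =
    \sum_i \sum_j form (weight G i j) (submxcol x i) (submxcol x i).
  by rewrite form_mxdiag; apply: eq_bigr => i _; rewrite block_degreeE form_sum.
rewrite mulr2n mulrDl !mul1r; congr (_ + _).
by apply: eq_bigr => i _; apply: eq_bigr => j _; rewrite weightC.
Qed.

Lemma form_degree_adjacency (s : R) x : s ^+ 2 = 1 ->
  2%:R * (form (degree_mx G) x x + s * form (adjacency_mx G) x x) =
  \sum_i \sum_j form (weight G i j) (submxcol x i + s *: submxcol x j)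
                                    (submxcol x i + s *: submxcol x j).
Proof.
move=> s2; rewrite mulrDr form_degree form_mxblock mulrA mulr_sumr -big_split /=.
apply: eq_bigr => i _; rewrite mulr_sumr -big_split /=; apply: eq_bigr => j _ /=.
rewrite !(formDl, formDr, formZl, formZr).
rewrite (formC (submxcol x j) (submxcol x i)); last by case: (psdmx_weight i j).
by ring: s2.
Qed.

Lemma psdmx_laplacian : psdmx (laplacian G).
Proof.
split=> [|x]; first exact: laplacian_sym.
rewrite -/(form _ x x) formD formN -(@pmulr_rge0 _ 2%:R) // -mulN1r.
rewrite form_degree_adjacency ?sqrrN ?expr1n //.
apply: sumr_ge0 => i _; apply: sumr_ge0 => j _; apply: psdmx_form_ge0.
exact: psdmx_weight.
Qed.

Lemma degree_adjacency_ge0 x :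
  0 <= form (degree_mx G) x x + form (adjacency_mx G) x x.
Proof.
rewrite -(@pmulr_rge0 _ 2%:R) // -[X in _ + X]mul1r.
rewrite form_degree_adjacency ?expr1n //.
apply: sumr_ge0 => i _; apply: sumr_ge0 => j _; apply: psdmx_form_ge0.
exact: psdmx_weight.
Qed.

Lemma laplacian_consensus (v : 'cV[R]_d) :
  laplacian G *m ckron (const_mx 1 : 'cV[R]_n) v = 0.
Proof.
rewrite mulmxBl mul_mxdiag_mxcol mul_mxblock_mxrow -mxcolB.
apply/mxcolP => i; rewrite mxcolK submxcol0 block_degreeE mulmx_suml.
by apply/eqP; rewrite subr_eq0; apply/eqP/eq_bigr => j _; rewrite !mxE.
Qed.

Variable beta : 'I_n -> R.
Hypothesis beta_gt0 : forall i, 0 < beta i.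

Lemma form_gain x : form (gain_mx G beta) x x =
  \sum_i (opnorm2 (block_degree G i) + beta i) * norm2 (submxcol x i) ^+ 2.
Proof.
rewrite form_mxdiag; apply: eq_bigr => i _.
by rewrite formZ norm2_sqr /step_size invrK.
Qed.

Lemma sum_blocks_gt0 (c : 'I_n -> R) x : (forall i, 0 < c i) -> x != 0 ->
  0 < \sum_i c i * norm2 (submxcol x i) ^+ 2.
Proof.
move=> c0 x0; have ge0 i : 0 <= c i * norm2 (submxcol x i) ^+ 2.
  by rewrite mulr_ge0 ?sqr_ge0 // ltW.
rewrite lt0r sumr_ge0 // andbT psumr_eq0 //; apply: contra x0 => /allP h.
apply/eqP/mxcolP => i; rewrite submxcol0; apply/eqP.
have := h i (mem_index_enum _).
by rewrite mulf_eq0 gt_eqF //= sqrf_eq0 norm2_eq0.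
Qed.

Lemma gain_sym : (gain_mx G beta)^T = gain_mx G beta.
Proof.
by rewrite tr_mxdiag; apply: eq_mxdiag => i; rewrite linearZ /= trmx1.
Qed.

Lemma pdmx_gain : pdmx (gain_mx G beta).
Proof.
split=> [|x x0]; first exact: gain_sym.
rewrite form_gain; apply: sum_blocks_gt0 => // i.
by rewrite ltr_wpDl ?opnorm2_ge0.
Qed.

(** [2 G - L] is [2 (G - D) + (D + A)].  Each block of [G - D] is at least
    [beta i], and [D + A] is semidefinite like [D - A]. *)
Lemma pdmx_gain_laplacian :
  pdmx (2%:R *: gain_mx G beta - laplacian G).
Proof.
split=> [|x x0]; first by rewrite linearB linearZ /= gain_sym laplacian_sym.
have DA := degree_adjacency_ge0 x.
have GD : 0 < form (gain_mx G beta) x x - form (degree_mx G) x x.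
  apply: lt_le_trans (sum_blocks_gt0 beta_gt0 x0) _.
  rewrite form_gain form_mxdiag -sumrB; apply: ler_sum => i _.
  by rewrite mulrDl addrAC lerDr subr_ge0 form_le_opnorm2.
rewrite formD formZ formN formD formN; lra.
Qed.

End Graph.

(** * Geometric convergence of constant sequences *)

(** For [0 <= q < 1] the bound [k q^k (1 - q) <= 1 - q^k] shows that [k q^k]
    stays bounded, so that [q^k] decreases at least like [1 / k]. *)
Lemma geometric_bound_le0 (R : realType) (t C q : R) :
  0 <= C -> 0 <= q < 1 -> (forall k, t <= C * q ^+ k) -> t <= 0.
Proof.
move=> C0 /andP[q0 q1] h.
have hk k : q ^+ k *+ k * (1 - q) <= 1 - q ^+ k.
  elim: k => [|k]; first by rewrite mulr0n mul0r expr0 subrr.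
  have := exprn_ile1 k.+1 q0 (ltW q1); rewrite exprS mulrS -mulrnAr.
  move: (q ^+ k *+ k) (q ^+ k) => a b qb1 /(ler_wpM2l q0) ih.
  have : 0 <= (1 - q) * (1 - q * b) by rewrite mulr_ge0 ?subr_ge0 // ltW.
  by lra.
rewrite leNgt; apply/negP => t0.
have p0 : 0 < 1 - q by rewrite subr_gt0.
have [k hkt] : exists k : nat, C / (1 - q) / t < k%:R.
  exists (Num.bound (C / (1 - q) / t)); apply: archi_boundP.
  by rewrite !divr_ge0 // ltW.
suff : k%:R * t <= C / (1 - q) by rewrite -ler_pdivlMr // leNgt hkt.
rewrite ler_pdivlMr //; apply: le_trans (_ : k%:R * (C * q ^+ k) * (1 - q) <= _).
  by rewrite ler_pM2r // ler_wpM2l.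
rewrite mulrCA -mulrA mulr_natl -[leRHS]mulr1 ler_wpM2l //.
by rewrite (le_trans (hk k)) // lerBlDr lerDl exprn_ge0.
Qed.

Lemma cvg_geometrically_cst (R : realType) (m : nat) (u l : 'cV[R]_m) :
  cvg_geometrically (fun=> u) l -> u = l.
Proof.
case=> C [q [C0 q01 h]]; apply/eqP; rewrite -subr_eq0 -norm2_eq0.
by rewrite eq_le norm2_ge0 (geometric_bound_le0 C0 q01 h).
Qed.

Theorem theorem1 (R : realType) (n d : nat) (hd : (2 <= d)%N)
    (G : mwgraph R n d) (hund : undirected G) (hconn : graph_connected G)
    (hsym : symmetric_weights G)
    (beta : 'I_n -> R) (hbeta : forall i, 0 < beta i) :
  (forall x : nat -> 'cV[R]_(\sum_(i < n) d),
     (forall k : nat, x k.+1 = iteration_mx G beta *m x k) ->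
     exists xhat : 'cV[R]_d,
       cvg_geometrically x (ckron (const_mx 1 : 'cV[R]_n) xhat))
  <->
  null (laplacian G) =
    mxrange (ckron (const_mx 1 : 'cV[R]_n) (1%:M : 'M[R]_d)).
Proof.
have consensusE (v : 'cV[R]_d) : ckron (const_mx 1 : 'cV[R]_n) 1%:M *m v =
    ckron (const_mx 1 : 'cV[R]_n) v by rewrite ckron_mul mul1mx.
split=> [cvg_all|nullL x hx].
  apply/seteqP; split=> [u Lu|_ [v _ <-]]; last first.
    by rewrite /null /= consensusE laplacian_consensus.
  have [k|v cv] := cvg_all (fun=> u).
    by rewrite mulmxBl mul1mx -mulmxA Lu mulmx0 subr0.
  by exists v => //; rewrite consensusE -(cvg_geometrically_cst cv).
have [u [Lu cu]] := iteration_cvg (psdmx_laplacian hund hsym)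
  (pdmx_gain G hbeta) (pdmx_gain_laplacian hund hsym hbeta) hx.
have : null (laplacian G) u by [].
by rewrite nullL => -[v _ ev]; exists v; rewrite -consensusE ev.
Qed.
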